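(* Let $n>1$ and let $\mathcal{P}\subset\mathbb{R}^n$ be the boundary of a convex polytope whose bounding hyperplanes are $\{H_j:j\in J\}$, where $J\subset\mathbb{R}\setminus\{0\}$ is an arithmetic progression of length $m$, $H_j=\{y:\langle y,\vec u_j\rangle=d_j\}$ with $\vec u_j$ the unit normal and $d_j>0$ the distance of $H_j$ from the origin, and suppose $d_j=(\vec u_j)_1/j$ for all $j\in J$, where $(\vec u_j)_1$ is the first coordinate of $\vec u_j$. Then \[h^M_n(\mathcal{P})=h^P_n(\mathcal{P})=n-1+f(m).\]
   Context: A homothet of $\mathcal{P}$ centered at $x$ is $x+r\mathcal{P}$ with $r>0$. $h^M_n(\mathcal{P})$ (resp. $h^P_n(\mathcal{P})$) is the minimal Minkowski (resp. packing) dimension of a set in $\mathbb{R}^n$ containing a homothet of $\mathcal{P}$ centered at each point of the segment $[0,1]\times\{0\}^{n-1}$. $f(m)$ is the infimum of the Minkowski dimension (equivalently, of the packing dimension) of a set in $\mathbb{R}$ containing an $m$-term arithmetic progression with every common difference in $[0,1]$. *)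

(* Defs.v *)
From HB Require Import structures.
From mathcomp Require Import all_boot all_order all_algebra.
From mathcomp Require Import all_classical all_reals all_analysis.

Set Implicit Arguments.
Unset Strict Implicit.
Unset Printing Implicit Defensive.

Import Order.TTheory GRing.Theory Num.Theory.
Import numFieldNormedType.Exports.

Local Open Scope classical_set_scope.
Local Open Scope ring_scope.

(* On 'rV[R]_n the balls are those of the sup norm, i.e. axis-parallel cubes;
   the dimensions below do not depend on this choice of norm. *)
Definition covered_by (R : realType) (V : pseudoMetricType R)
    (A : set V) (e : R) (k : nat) : Prop :=
  exists c : 'I_k -> V, A `<=` \bigcup_(i in [set: 'I_k]) ball (c i) e.

(* +oo when A has no finite cover by e-balls, e.g. when A is unbounded. *)
Definition covering_number (R : realType) (V : pseudoMetricType R)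
    (A : set V) (e : R) : \bar R :=
  ereal_inf [set (k%:R)%:E | k in [set k : nat | covered_by A e k]].

(* The upper Minkowski (box-counting) dimension,
   limsup_(e -> 0+) log N(A, e) / log (1 / e). *)
Definition minkowski_dim (R : realType) (V : pseudoMetricType R)
    (A : set V) : \bar R :=
  limf_esup
    (fun e : R => (lne (covering_number A e) * ((ln e^-1)^-1)%:E)%E) 0^'+.

(* Packing dimension as the countably stable modification of the upper
   Minkowski dimension. *)
Definition packing_dim (R : realType) (V : pseudoMetricType R)
    (A : set V) : \bar R :=
  ereal_inf [set ereal_sup (range (fun k : nat => minkowski_dim (F k))) |
             F in [set F : nat -> set V | A `<=` \bigcup_k F k]].

Definition dotp (R : realType) (n : nat) (x y : 'rV[R]_n) : R :=
  \sum_(i < n) x 0 i * y 0 i.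

Definition hyperplane (R : realType) (n : nat) (u : 'rV[R]_n) (d : R) :
    set 'rV[R]_n :=
  [set y | dotp y u = d].

Definition closed_side (R : realType) (n : nat) (u : 'rV[R]_n) (d : R)
    (s : bool) : set 'rV[R]_n :=
  [set y | if s then dotp y u <= d else d <= dotp y u].

Definition coord_bounded (R : realType) (n : nat) (K : set 'rV[R]_n) : Prop :=
  exists M : R, forall y, K y -> forall i, `|y 0 i| <= M.

(* The intersection of K with the hyperplane has nonempty relative interior,
   i.e. dimension n - 1. *)
Definition facet_hyperplane (R : realType) (n : nat) (K : set 'rV[R]_n)
    (u : 'rV[R]_n) (d : R) : Prop :=
  exists y : 'rV[R]_n, exists e : R,
    [/\ 0 < e, hyperplane u d y & ball y e `&` hyperplane u d `<=` K].

(* K is a full-dimensional convex polytope whose bounding (facet) hyperplanes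
   are the {y : <y, u j> = d j}, j in J.  The side s j of each hyperplane on
   which K lies is free: the origin need not belong to K. *)
Definition polytope_with_bounding_hyperplanes (R : realType) (n : nat)
    (J : set R) (u : R -> 'rV[R]_n) (d : R -> R) (K : set 'rV[R]_n) : Prop :=
  [/\ coord_bounded K,
      K° !=set0,
      exists s : R -> bool,
        K = \bigcap_(j in J) closed_side (u j) (d j) (s j)
    & forall j, J j -> facet_hyperplane K (u j) (d j)].

Definition boundary (T : topologicalType) (A : set T) : set T :=
  closure A `\` A°.

(* A nonzero step makes the m terms distinct. *)
Definition arithmetic_progression (R : realType) (m : nat) (J : set R) : Prop :=
  exists a : R, exists s : R,
    s != 0 /\ J = [set a + k%:R * s | k in [set k : nat | (k < m)%N]].

(* [0, 1] x {0}^(n - 1) *)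
Definition unit_segment (R : realType) (n : nat) : set 'rV[R]_n :=
  [set x | forall i : 'I_n,
    if i == 0%N :> nat then 0 <= x 0 i <= 1 else x 0 i == 0].

Definition homothet (R : realType) (n : nat) (P : set 'rV[R]_n)
    (x : 'rV[R]_n) (r : R) : set 'rV[R]_n :=
  [set x + r *: p | p in P].

Definition contains_homothets (R : realType) (n : nat)
    (P B : set 'rV[R]_n) : Prop :=
  forall x, unit_segment x -> exists2 r : R, 0 < r & homothet P x r `<=` B.

Definition hM (R : realType) (n : nat) (P : set 'rV[R]_n) : \bar R :=
  ereal_inf [set minkowski_dim B | B in contains_homothets P].

Definition hP (R : realType) (n : nat) (P : set 'rV[R]_n) : \bar R :=
  ereal_inf [set packing_dim B | B in contains_homothets P].

Definition contains_progressions (R : realType) (m : nat) (A : set R) : Prop :=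
  forall t : R, 0 <= t <= 1 ->
    exists a : R, forall k : nat, (k < m)%N -> A (a + k%:R * t).

Definition progression_dim (R : realType) (m : nat) : \bar R :=
  ereal_inf [set @minkowski_dim R R A | A in @contains_progressions R m].

(* Main.v *)
(* At the point t e_1, the homothet of ratio r has its j-th face on
   the hyperplane <y, u_j> = d_j (r + j t), because d_j j is the first
   coordinate of u_j.  The numbers r + j t, j in J, form a progression whose
   common difference is proportional to t.
   Upper bound: given A containing progressions, the union over j of the
   bounded slabs {<y, u_j> in d_j A'}, with A' an affine image of A, contains
   the required homothets, and a slab has n - 1 more dimensions than A.
   Lower bound: if the homothets are covered by countably many closed sets
   F_k, Baire's theorem puts in some F_k a relatively open piece of each face,
   over a cube taken from a countable list; Baire's theorem in t then makes
   these choices constant on a set of t dense in an interval.  A pigeonhole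
   over a grid of the cube shows that the corresponding offsets have dimension
   at least n - 1 less than F_k, and their closure contains progressions with
   all common differences in an interval; translating its copies by multiples
   of the left endpoint yields all differences in [0, 1] after rescaling. *)
Require Import Defs.
From HB Require Import structures.
From mathcomp Require Import all_boot all_order all_algebra.
From mathcomp Require Import all_classical all_reals all_analysis.
From mathcomp Require Import lra ring.
Import Order.TTheory GRing.Theory Num.Theory.
Import numFieldNormedType.Exports.
Local Open Scope classical_set_scope.
Local Open Scope ring_scope.

Set Implicit Arguments.
Unset Strict Implicit.
Unset Printing Implicit Defensive.

Local Notation covered_by := Defs.covered_by.

(** * Polynomial rates of covering numbers *)

(** Box counting with exponent [q] up to constants: a dimension below [q] gives this rate, and this
    rate gives a dimension at most [q]. The factor [L] on the radius absorbs Lipschitz constants. *)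
Definition covering_rate {R : realType} {V : pseudoMetricType R}
    (A : set V) (q : R) : Prop :=
  exists L C dl : R, [/\ 0 < L, 0 < dl &
    forall e : R, 0 < e < dl ->
      exists2 k : nat, covered_by A (L * e) k & k%:R <= C * e `^ (- q)].

Section CoveringRate.
Context {R : realType}.
Implicit Types V W : pseudoMetricType R.

Lemma covered_by_fin V (A : set V) (e : R) (T : finType) (c : T -> V) :
  A `<=` \bigcup_(i in [set: T]) ball (c i) e -> covered_by A e #|T|.
Proof.
move=> Ac; exists (fun i => c (enum_val i)) => x /Ac[i _ xi].
by exists (enum_rank i) => //; rewrite enum_rankK.
Qed.

Lemma covered_by_le V (A : set V) (e e' : R) k :
  e <= e' -> covered_by A e k -> covered_by A e' k.
Proof.
move=> ee' [c Ac]; exists c => x /Ac[i _ xi].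
by exists i => //; exact: le_ball xi.
Qed.

Lemma covering_number_ge0 V (A : set V) (e : R) :
  (0 <= covering_number A e)%E.
Proof. by apply/ereal_infP => _ [k _ <-]; rewrite lee_fin. Qed.

Lemma ln_powR_inv (e q : R) : 0 < e -> q * ln e^-1 = ln (e `^ (- q)).
Proof. by move=> e0; rewrite ln_powR lnV ?posrE// mulrN mulNr. Qed.

Lemma minkowski_dim_lt_rate V (A : set V) (q : R) :
  (minkowski_dim A < q%:E)%E -> covering_rate A q.
Proof.
case/ereal_inf_lt => _ [U [d /= d0 dU] <-] supU.
(* Below scale 1 the divisor [ln e^-1] is positive and can be cleared. *)
exists 1, 1, (Num.min d 1); split => //; first by rewrite lt_min d0 ltr01.
move=> e /andP[e0]; rewrite lt_min => /andP[ed e1].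
have Ue : U e by apply: dU => //=; rewrite sub0r normrN gtr0_norm.
have l0 : 0 < ln e^-1 by rewrite ln_gt0// invf_gt1.
have : (lne (covering_number A e) < (q * ln e^-1)%:E)%E.
  have := le_lt_trans (ereal_sup_ubound (imageP _ Ue)) supU.
  by rewrite lte_pdivrMr// -EFinM.
rewrite ln_powR_inv// -lne_EFin ?powR_gt0//.
have := covering_number_ge0 A e => N0.
rewrite lte_lne ?in_itv/= ?N0 ?leey ?lee_fin ?powR_ge0//.
by case/ereal_inf_lt => _ [k Ak <-]; rewrite lte_fin => /ltW ke;
  exists k; rewrite mul1r.
Qed.

Lemma rate_minkowski_dim_le V (A : set V) (q : R) :
  covering_rate A q -> (minkowski_dim A <= q%:E)%E.
Proof.
move=> [L [C [dl [L0 dl0 AC]]]]; apply/lee_addgt0Pr => eps eps0.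
(* Using the rate at scale [e / L] costs a constant factor at most [D], which e to the power [- eps]
   absorbs for small [e]. *)
pose D := `|C * L `^ q| + 1.
have D0 : 0 < D by rewrite ltr_wpDl.
have : \forall e \near (0 : R)^'+, [/\ 0 < e, e < 1, e < L * dl
    & e `^ eps < D^-1].
  near=> e; split; near: e.
  - exact: nbhs_right_gt.
  - exact: nbhs_right_lt.
  - by apply: nbhs_right_lt; rewrite mulr_gt0.
  - have /cvgr_lt := powR_cvg0 eps0; apply; by rewrite invr_gt0.
move=> nearU; apply: ge_ereal_inf; eexists; first by eexists; [exact: nearU|reflexivity].
apply: ge_ereal_sup => _ [e [e0 e1 eL eD] <-].
have l0 : 0 < ln e^-1 by rewrite ln_gt0// invf_gt1.
rewrite lee_pdivrMr// -EFinD -EFinM ln_powR_inv// -lne_EFin ?powR_gt0//.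
rewrite lee_lne ?in_itv/= ?covering_number_ge0 ?leey ?lee_fin ?powR_ge0//.
have [|k Ak kC] := AC (e / L).
  by rewrite divr_gt0//= ltr_pdivrMr// mulrC.
apply: ge_ereal_inf; exists k%:R%:E.
  by exists k => //=; rewrite mulrC divfK ?gt_eqF// in Ak.
rewrite lee_fin (le_trans kC)// powRM ?invr_ge0 ?(ltW L0) ?(ltW e0)//.
rewrite -[L^-1]powR_inv1 ?(ltW L0)// -powRrM mulN1r opprK.
rewrite [X in C * X]mulrC mulrA opprD powRD; last by rewrite (gt_eqF e0) implybT.
rewrite [leRHS]mulrC ler_wpM2r ?powR_ge0// powRN.
rewrite (@le_trans _ _ D)//; first by rewrite (le_trans (ler_norm _))// lerDl.
by rewrite -[D]invrK lef_pV2 ?posrE ?invr_gt0 ?powR_gt0// ltW.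
Unshelve. all: by end_near. Qed.

Lemma rate_subset V (A B : set V) (q : R) :
  A `<=` B -> covering_rate B q -> covering_rate A q.
Proof.
move=> AB [L [C [dl [L0 dl0 BC]]]]; exists L, C, dl; split => // e /BC[k [c Bc] kC].
by exists k => //; exists c; exact: subset_trans Bc.
Qed.

Lemma rate_lipschitz V W (f : V -> W) (M : R) (A : set V) (q : R) : 0 < M ->
  (forall x y e, ball x e y -> ball (f x) (M * e) (f y)) ->
  covering_rate A q -> covering_rate (f @` A) q.
Proof.
move=> M0 fM [L [C [dl [L0 dl0 AC]]]]; exists (M * L), C, dl.
split => //; first exact: mulr_gt0.
move=> e /AC[k [c Ac] kC]; exists k => //; exists (f \o c).
by move=> _ [x /Ac[i _ xi] <-]; exists i => //=; rewrite -mulrA; exact: fM.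
Qed.

Lemma rate_affine (A : set R) (a b q : R) : covering_rate A q ->
  covering_rate [set a * x + b | x in A] q.
Proof.
apply: (@rate_lipschitz _ _ _ (`|a| + 1)); first by rewrite ltr_wpDl.
move=> x y e; rewrite /ball/= => xy.
rewrite opprD addrACA subrr addr0 -mulrBr normrM.
rewrite (@le_lt_trans _ _ ((`|a| + 1) * `|x - y|))//.
  by rewrite ler_wpM2r// lerDl.
by rewrite ltr_pM2l// ltr_wpDl.
Qed.

(** Points of the closure lie within [L * e] of points of [A], so doubling the radii of a cover
    suffices. *)
Lemma rate_closure V (A : set V) (q : R) :
  covering_rate A q -> covering_rate (closure A) q.
Proof.
move=> [L [C [dl [L0 dl0 AC]]]]; exists (L + L), C, dl; split => //.
  exact: addr_gt0.
move=> e /[dup] /andP[e0 _] /AC[k [c Ac] kC]; exists k => //; exists c => x clx.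
have Le0 : 0 < L * e by exact: mulr_gt0.
have [y [/Ac[i _ ciy] xy]] := clx _ (nbhsx_ballx x _ Le0).
exists i => //; rewrite mulrDl; apply: ball_triangle ciy _.
exact: ball_sym.
Qed.

Lemma rate_setU V (A B : set V) (q : R) :
  covering_rate A q -> covering_rate B q -> covering_rate (A `|` B) q.
Proof.
move=> [L [C [dl [L0 dl0 AC]]]] [L' [C' [dl' [L'0 dl'0 BC]]]].
exists (Num.max L L'), (C + C'), (Num.min dl dl'); split.
- by rewrite lt_max L0.
- by rewrite lt_min dl0.
move=> e /andP[e0]; rewrite lt_min => /andP[el el'].
have [|k Ak kC] := AC e; first exact/andP.
have [|k' Bk' k'C] := BC e; first exact/andP.
exists (k + k')%N; last by rewrite natrD mulrDl lerD.
have {Ak} [c Ac] : covered_by A (Num.max L L' * e) k.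
  by apply: covered_by_le Ak; rewrite ler_pM2r// le_max lexx.
have {Bk'} [c' Bc'] : covered_by B (Num.max L L' * e) k'.
  by apply: covered_by_le Bk'; rewrite ler_pM2r// le_max lexx orbT.
have := @covered_by_fin _ (A `|` B) (Num.max L L' * e) ('I_k + 'I_k')%type
  (fun i => match i with inl i => c i | inr i => c' i end).
rewrite card_sum !card_ord; apply => x [/Ac|/Bc'] [i _ xi].
- by exists (inl i).
- by exists (inr i).
Qed.

Lemma rate_set0 V (q : R) : covering_rate (set0 : set V) q.
Proof.
exists 1, 0, 1; split => // e _; exists 0%N; last by rewrite mul0r.
by exists (fun i : 'I_0 => match notF (ltn_ord i) with end).
Qed.

Lemma rate_bigcup V (m : nat) (A : nat -> set V) (q : R) :
  (forall k, (k < m)%N -> covering_rate (A k) q) ->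
  covering_rate (\bigcup_(k in [set k | (k < m)%N]) A k) q.
Proof.
move=> Aq; rewrite bigcup_mkord; elim: m Aq => [|m IHm] Aq.
  by rewrite big_ord0; exact: rate_set0.
by rewrite big_ord_recr/=; apply: rate_setU;
  [apply: IHm => k /ltnW; exact: Aq|exact: Aq].
Qed.

Lemma rate_bounded (A : set R) (q : R) : covering_rate A q ->
  exists M : R, forall x, A x -> `|x| <= M.
Proof.
move=> [L [C [dl [L0 dl0 AC]]]].
have [|k [c Ac] _] := AC (dl / 2).
  by rewrite divr_gt0//= ltr_pdivrMr// ltr_pMr// ltr1n.
exists (\sum_i `|c i| + L * (dl / 2)) => x /Ac[i _]; rewrite /ball/= => xi.
rewrite (bigD1 i)//= -addrA addrC -[x](subrKC (c i)) (le_trans (ler_normD _ _))//.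
rewrite [leRHS]addrC lerD// distrC (le_trans (ltW xi))// lerDr.
exact: sumr_ge0.
Qed.

End CoveringRate.

(** * Hyperplanes as graphs *)

Section HyperplaneGraph.
Context {R : realType} {n : nat}.
Implicit Types (u y : 'rV[R]_n.+1) (z : 'rV[R]_n) (a e q : R).

Lemma row_ballP (k : nat) (x y : 'rV[R]_k) e :
  ball x e y <-> 0 < e /\ forall i, `|x 0 i - y 0 i| < e.
Proof.
split=> -[e0 xy]; split=> // i; first exact: (xy 0 i).
by move=> j; rewrite ord1; exact: xy.
Qed.

(* The point of the hyperplane [dotp y u = a] whose coordinates other than
   the [i0]-th are those of [z]. *)
Definition hyperplane_point u (i0 : 'I_n.+1) z a : 'rV[R]_n.+1 :=
  \row_i if unlift i0 i is Some j then z 0 j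
         else (a - \sum_j z 0 j * u 0 (lift i0 j)) / u 0 i0.

Lemma hyperplane_point_lift u (i0 : 'I_n.+1) z a j :
  hyperplane_point u i0 z a 0 (lift i0 j) = z 0 j.
Proof. by rewrite mxE liftK. Qed.

Lemma hyperplane_point_i0 u (i0 : 'I_n.+1) z a :
  hyperplane_point u i0 z a 0 i0 =
  (a - \sum_j z 0 j * u 0 (lift i0 j)) / u 0 i0.
Proof. by rewrite mxE unlift_none. Qed.

Lemma dotp_lift u (i0 : 'I_n.+1) y :
  dotp y u = y 0 i0 * u 0 i0 + \sum_j y 0 (lift i0 j) * u 0 (lift i0 j).
Proof. by rewrite /dotp (bigD1_ord i0). Qed.

Lemma dotp_hyperplane_point u (i0 : 'I_n.+1) z a :
  u 0 i0 != 0 -> dotp (hyperplane_point u i0 z a) u = a.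
Proof.
move=> ui0; rewrite (dotp_lift _ i0) hyperplane_point_i0 divfK//.
by under [in X in _ + X]eq_bigr do rewrite hyperplane_point_lift; rewrite subrK.
Qed.

Lemma hyperplane_pointK u (i0 : 'I_n.+1) y :
  u 0 i0 != 0 -> hyperplane_point u i0 (col' i0 y) (dotp y u) = y.
Proof.
move=> ui0; apply/rowP => i; case: (unliftP i0 i) => [j|] ->.
  by rewrite hyperplane_point_lift mxE.
rewrite hyperplane_point_i0 (dotp_lift _ i0).
under [X in _ - X]eq_bigr do rewrite mxE.
by rewrite addrK mulfK.
Qed.

Lemma ball_dotp u (x y : 'rV[R]_n.+1) e : ball x e y ->
  ball (dotp x u) ((\sum_i `|u 0 i| + 1) * e) (dotp y u).
Proof.
move=> /row_ballP[e0 xy]; rewrite /ball/= /dotp -sumrB.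
apply: (le_lt_trans (ler_norm_sum _ _ _)).
apply: (@le_lt_trans _ _ ((\sum_i `|u 0 i|) * e)).
  rewrite mulr_suml ler_sum// => i _.
  by rewrite -mulrBl normrM mulrC ler_wpM2l// ltW.
by rewrite ltr_pM2r// ltrDl.
Qed.

(** A Lipschitz constant of [hyperplane_point] in [(z, a)] for the sup norm: the quotient serves the
    solved coordinate [i0], the last 1 the copied ones. *)
Definition graph_lip u (i0 : 'I_n.+1) : R :=
  (\sum_j `|u 0 (lift i0 j)| + 1) / `|u 0 i0| + 1.

Lemma graph_lip_gt0 u (i0 : 'I_n.+1) : 0 < graph_lip u i0.
Proof.
by rewrite ltr_wpDl// divr_ge0// addr_ge0// sumr_ge0.
Qed.

Lemma ball_hyperplane_point u (i0 : 'I_n.+1) z (z' : 'rV[R]_n) a (a' : R) e :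
  u 0 i0 != 0 -> 0 < e -> (forall j, `|z 0 j - z' 0 j| < e) -> `|a - a'| < e ->
  ball (hyperplane_point u i0 z a) (graph_lip u i0 * e)
       (hyperplane_point u i0 z' a').
Proof.
move=> ui0 e0 zz' aa'; apply/row_ballP; split; first by rewrite mulr_gt0// graph_lip_gt0.
move=> i; case: (unliftP i0 i) => [j|] ->.
  rewrite !hyperplane_point_lift (lt_le_trans (zz' j))//.
  by rewrite ler_peMl ?(ltW e0)// /graph_lip lerDr divr_ge0// addr_ge0// sumr_ge0.
rewrite !hyperplane_point_i0 -mulrBl normrM normfV ltr_pdivrMr ?normr_gt0//.
rewrite opprD addrACA -opprD -sumrB mulrAC /graph_lip mulrDl divfK ?normr_eq0// mul1r.
apply: (@lt_le_trans _ _ ((\sum_j `|u 0 (lift i0 j)| + 1) * e)); last first.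
  by rewrite ler_pM2r// lerDl.
rewrite mulrDl mul1r (le_lt_trans (ler_normB _ _))//.
rewrite [ltRHS]addrC ltr_leD// (le_trans (ler_norm_sum _ _ _))// mulr_suml ler_sum// => j _.
by rewrite -mulrBl normrM mulrC ler_wpM2l// ltW.
Qed.

Lemma powR_negD (k : nat) e q : 0 < e ->
  e `^ (- (k%:R + q)) = e^-1 ^+ k * e `^ (- q).
Proof.
move=> e0; rewrite opprD powRD; last by rewrite (gt_eqF e0) implybT.
by rewrite (powRN e k%:R) powR_mulrn ?(ltW e0)// exprVn.
Qed.

(** The graph map carries a grid of mesh [L * e] in the [n] free coordinates, times a cover of the
    offsets, to a cover of the slab; the grid has of the order of e^-n nodes. *)
Lemma rate_slab u (i0 : 'I_n.+1) (A : set R) (M : R) q :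
  u 0 i0 != 0 -> 0 <= M -> covering_rate A q ->
  covering_rate [set y : 'rV[R]_n.+1 | (forall i, `|y 0 i| <= M) /\ A (dotp y u)] (n%:R + q).
Proof.
move=> ui0 M0 [L [C [dl [L0 dl0 AC]]]].
(* [D / e] bounds the number [p] of nodes per coordinate: the 1 added in rounding up is at most
   [dl / e]. *)
pose D := 2 * M / L + dl.
exists (graph_lip u i0 * L), (D ^+ n * C), dl; split=> //.
  by rewrite mulr_gt0// graph_lip_gt0.
move=> e /[dup] /andP[e0 edl] /AC[k [c Ac] kC].
have Le0 : 0 < L * e by exact: mulr_gt0.
have LM0 : 0 <= 2 * M / (L * e) by rewrite divr_ge0 ?(ltW Le0)// mulr_ge0.
pose p := (Num.truncn (2 * M / (L * e))).+1.
pose zg (g : {ffun 'I_n -> 'I_p}) : 'rV[R]_n :=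
  \row_j (- M + (g j)%:R * (L * e)).
exists (p ^ n * k)%N.
  have := @covered_by_fin _ _ [set y : 'rV[R]_n.+1 |
    (forall i, `|y 0 i| <= M) /\ A (dotp y u)]
    (graph_lip u i0 * L * e) ({ffun 'I_n -> 'I_p} * 'I_k)%type
    (fun gi => hyperplane_point u i0 (zg gi.1) (c gi.2)).
  rewrite card_prod card_ffun !card_ord; apply => y [yM Ay].
  have [i _ ci] := Ac _ Ay.
  have idx j : (Num.truncn ((y 0 (lift i0 j) + M) / (L * e))%R < p)%N.
    rewrite ltnS; apply: le_truncn; rewrite ler_pM2r ?invr_gt0//.
    by have := yM (lift i0 j); rewrite ler_norml => /andP[_ ?]; lra.
  exists ([ffun j => Ordinal (idx j)], i) => //=.
  rewrite -mulrA -{2}[y](hyperplane_pointK y ui0).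
  apply: ball_hyperplane_point => // j; rewrite !mxE ffunE/=.
  set x := y 0 (lift i0 j).
  have x0 : 0 <= (x + M) / (L * e).
    rewrite divr_ge0 ?(ltW Le0)//.
    by have := yM (lift i0 j); rewrite ler_norml => /andP[? _]; rewrite /x; lra.
  have := truncn_itv x0; set t := Num.truncn _ => /andP[t1 t2].
  move: t1 t2; rewrite ler_pdivlMr// ltr_pdivrMr// -natr1 mulrDl mul1r => t1 t2.
  by rewrite ltr_norml; apply/andP; split; lra.
rewrite natrM natrX powR_negD// mulrACA -exprMn.
apply: ler_pM => //.
apply: lerXn2r; rewrite ?nnegrE//.
  by rewrite divr_ge0 ?(ltW e0)// addr_ge0 ?(ltW dl0)// divr_ge0 ?(ltW L0)// mulr_ge0.
rewrite /p -natr1 [leRHS]mulrDl lerD//.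
  by have /andP[+ _] := truncn_itv LM0 => /le_trans -> //; rewrite invfM mulrA.
by rewrite ler_pdivlMr// mul1r ltW.
Qed.

(* Each ball of a cover of [F] meets the pieces over at most one node of a
   grid whose mesh exceeds the diameter of the balls, so that some node is
   responsible for at most a [1 / p ^ n] fraction of the cover. *)
Lemma rate_offsets u (i0 : 'I_n.+1) (F : set 'rV[R]_n.+1) (S : set R) z
    (rho q : R) :
  u 0 i0 != 0 -> 0 < rho ->
  (forall a, S a -> forall z', (forall j, z 0 j <= z' 0 j <= z 0 j + rho) ->
    F (hyperplane_point u i0 z' a)) ->
  covering_rate F q -> covering_rate S (q - n%:R).
Proof.
move=> ui0 rho0 SF [L [C [dl [L0 dl0 FC]]]].
pose Lu := \sum_i `|u 0 i| + 1.
have Lu0 : 0 < Lu by rewrite ltr_wpDl// sumr_ge0.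
exists (Lu * L), ((2 * L / rho) ^+ n * C), dl; split => //; first exact: mulr_gt0.
move=> e /[dup] /andP[e0 edl] /FC[k [c Fc] kC].
have Le0 : 0 < L * e by exact: mulr_gt0.
have r0 : 0 <= rho / (2 * (L * e)) by rewrite divr_ge0 ?(ltW rho0)// mulr_ge0// ltW.
(* [p] nodes of spacing [2 * (L * e)] fit into an edge of length [rho], since the last one has index
   [p - 1]. *)
pose p := (Num.truncn (rho / (2 * (L * e)))).+1.
have /andP[t1 t2] := truncn_itv r0.
pose zg (g : {ffun 'I_n -> 'I_p}) : 'rV[R]_n :=
  \row_j (z 0 j + (g j)%:R * (2 * (L * e))).
have zgP g j : z 0 j <= zg g 0 j <= z 0 j + rho.
  rewrite mxE lerDl lerD2l mulr_ge0 ?mulr_ge0 ?(ltW L0) ?(ltW e0)//=.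
  rewrite -ler_pdivlMr ?mulr_gt0// (le_trans _ t1)// ler_nat.
  by rewrite -ltnS ltn_ord.
pose near_node (g : {ffun 'I_n -> 'I_p}) (i : 'I_k) :=
  [forall j, `|c i 0 (lift i0 j) - zg g 0 j| < L * e].
have near_uniq g g' i : near_node g i -> near_node g' i -> g = g'.
  move=> /forallP gi /forallP g'i; apply/ffunP => j; apply/val_inj => /=.
  move: (gi j) (g'i j); rewrite !mxE !ltr_norml => /andP[a1 a2] /andP[b1 b2].
  apply/eqP; rewrite eqn_leq; apply/andP; split;
    rewrite -ltnS -(ltr_nat R) -natr1 -(@ltr_pM2r _ (2 * (L * e))) ?mulr_gt0//;
    rewrite [ltRHS]mulrDl mul1r; lra.
have sum_near : (\sum_g #|[pred i | near_node g i]| <= k)%N.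
  under eq_bigr do rewrite -sum1_card big_mkcond/=.
  rewrite exchange_big/= -[leqRHS]card_ord -sum1_card; apply: leq_sum => i _.
  have [g gi|no] := pickP (fun g => near_node g i).
    rewrite (bigD1 g)//= big1 ?addn0; first by case: ifP.
    move=> g' g'g; rewrite inE; case: ifP => // g'i.
    by rewrite (near_uniq _ _ _ g'i gi) eqxx in g'g.
  by rewrite big1// => g _; rewrite inE no.
have [g kg] : exists g, (p ^ n * #|[pred i | near_node g i]| <= k)%N.
  apply: contrapT => /forallNP no.
  have : (\sum_(g : {ffun 'I_n -> 'I_p}) k.+1 <=
      \sum_(g : {ffun 'I_n -> 'I_p}) p ^ n * #|[pred i | near_node g i]|)%N.
    by apply: leq_sum => g _; rewrite ltnNge; exact/negP.
  rewrite sum_nat_const card_ffun !card_ord -big_distrr/= leq_pmul2l ?expn_gt0//.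
  by move=> /leq_trans/(_ sum_near); rewrite ltnn.
exists #|[pred i | near_node g i]|.
  have := @covered_by_fin _ _ S (Lu * L * e) {i | near_node g i}
    (fun i => dotp (c (val i)) u).
  rewrite card_sig; apply => a Sa.
  have [i _ ci] := Fc _ (SF _ Sa _ (zgP g)).
  have gi : near_node g i.
    apply/forallP => j; have /row_ballP[_ /(_ (lift i0 j))] := ci.
    by rewrite hyperplane_point_lift.
  exists (exist _ i gi) => //=; rewrite -mulrA -[a](dotp_hyperplane_point (zg g) a ui0).
  exact: ball_dotp.
(* Rounding up gives [p > X], so the fraction [1 / p ^ n] of the cover is at most [1 / X ^ n], which
   gains the factor e^n. *)
pose X := rho / (2 * (L * e)).
have X0 : 0 < X by rewrite divr_gt0// mulr_gt0.
rewrite -(@ler_pM2l _ (X ^+ n)) ?exprn_gt0//.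
have -> : X ^+ n * ((2 * L / rho) ^+ n * C * e `^ (- (q - n%:R))) =
    C * e `^ (- q).
  rewrite -[q in RHS](subrKC n%:R) powR_negD// !mulrA -exprMn.
  rewrite [in LHS](_ : X * _ = e^-1); last first.
    by rewrite /X; field; rewrite !gt_eqF.
  by rewrite [_ * C]mulrC.
apply: le_trans kC; apply: (@le_trans _ _ (p ^ n * #|[pred i | near_node g i]|)%:R).
  rewrite natrM natrX ler_wpM2r// lerXn2r ?nnegrE ?(ltW X0)//.
  exact: ltW.
by rewrite ler_nat.
Qed.

End HyperplaneGraph.

(** * Upper bound *)

Section PolytopeBoundary.
Context {R : realType} {n : nat}.
Implicit Types (u x y : 'rV[R]_n.+1) (K : set 'rV[R]_n.+1) (J : set R).

Lemma dotpDZl x y u (r : R) : dotp (x + r *: y) u = dotp x u + r * dotp y u.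
Proof.
rewrite /dotp mulr_sumr -big_split; apply: eq_bigr => i _ /=.
by rewrite !mxE mulrDl mulrA.
Qed.

Lemma unit_normal_coord u : dotp u u = 1 -> exists i, u 0 i != 0.
Proof.
move=> u1; apply: contrapT => /forallNP u0; move: u1; rewrite /dotp big1.
  by move/eqP; rewrite eq_sym oner_eq0.
by move=> i _; have /negP := u0 i; rewrite negbK => /eqP ->; rewrite mul0r.
Qed.

Lemma near_dotp u y (dl : R) : 0 < dl ->
  \forall x \near y, `|dotp y u - dotp x u| < dl.
Proof.
move=> dl0; have L0 : 0 < \sum_i `|u 0 i| + 1 by rewrite ltr_wpDl// sumr_ge0.
apply/nbhs_ballP; exists (dl / (\sum_i `|u 0 i| + 1)); first exact: divr_gt0.
by move=> x /(@ball_dotp _ _ u); rewrite mulrC divfK ?gt_eqF.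
Qed.

(** Off all the hyperplanes, each of the finitely many side conditions persists in a neighbourhood,
    so that a point of the closure is interior. *)
Lemma boundary_subset_hyperplanes (m : nat) (h : nat -> R) J (u_ : R -> 'rV[R]_n.+1)
    (d : R -> R) K (s : R -> bool) :
  J = [set h k | k in [set k | (k < m)%N]] ->
  K = \bigcap_(j in J) closed_side (u_ j) (d j) (s j) ->
  boundary K `<=` \bigcup_(j in J) hyperplane (u_ j) (d j).
Proof.
move=> JE KE y [clKy intKy]; apply: contrapT => yH; apply: intKy.
have side j : J j -> \forall x \near y, closed_side (u_ j) (d j) (s j) x.
  move=> Jj; have dlt : 0 < `|dotp y (u_ j) - d j|.
    by rewrite normr_gt0 subr_eq0; apply/eqP => yj; apply: yH; exists j.
  (* The side of [y] is read off a point [x] of [K] too close to [y] to be separated from it by the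
     hyperplane. *)
  have [x [Kx xy]] := clKy _ (near_dotp (u_ j) y dlt).
  have {Kx} : closed_side (u_ j) (d j) (s j) x by rewrite KE in Kx; exact: Kx.
  move=> xs; near=> w.
  have : `|dotp y (u_ j) - dotp w (u_ j)| < `|dotp y (u_ j) - d j|.
    by near: w; exact: near_dotp.
  move: xs xy; rewrite /closed_side/=.
  by case: (s j); case: (ger0P (dotp y (u_ j) - d j)) => ? ?;
    rewrite !ltr_norml => /andP[? ?] /andP[? ?]; lra.
rewrite /interior KE.
have : \forall x \near y, forall k : 'I_m,
    closed_side (u_ (h k)) (d (h k)) (s (h k)) x.
  apply: (@filter_forall _ _
    (fun k : 'I_m => closed_side (u_ (h k)) (d (h k)) (s (h k)))
    (nbhs y) (nbhs_filter y)) => k.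
  by apply: side; rewrite JE; exists k => /=.
apply: filterS => x xs j; rewrite JE => -[k /= km <-].
exact: xs (Ordinal km).
Unshelve. all: by end_near. Qed.

(** A small move along the normal, away from [K], leaves the half-space, so no ball around [y] stays
    in [K]. *)
Lemma supporting_subset_boundary u (d : R) (s : bool) K y :
  dotp u u = 1 -> K `<=` closed_side u d s -> K y -> hyperplane u d y ->
  boundary K y.
Proof.
move=> u1 Ks Ky yd; split; first exact: subset_closure.
move=> /nbhs_ballP[e /= e0 eK].
(* [D] exceeds every coordinate of [u], so a move by [e / D] along [u] stays in the sup-norm ball of
   radius [e]. *)
pose D := \sum_i `|u 0 i| + 1.
have D0 : 0 < D by rewrite ltr_wpDl// sumr_ge0.
have uD i : `|u 0 i| < D.
  by rewrite /D (bigD1 i)//= -addrA ltrDl ltr_wpDl// sumr_ge0.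
have t0 : 0 < e / D by exact: divr_gt0.
have : closed_side u d s (y + (if s then e / D else - (e / D)) *: u).
  apply/Ks/eK/row_ballP; split=> // i.
  rewrite !mxE opprD addrA subrr sub0r normrN normrM.
  rewrite (_ : `|_| = e / D); last by case: (s); rewrite ?normrN gtr0_norm.
  by rewrite mulrAC ltr_pdivrMr// ltr_pM2l.
rewrite /closed_side/= dotpDZl yd u1 mulr1.
by case: (s); lra.
Qed.

Lemma dotp_unit_segment x u : unit_segment x ->
  dotp x u = x 0 ord0 * u 0 ord0.
Proof.
move=> xs; rewrite (dotp_lift _ ord0) big1 ?addr0// => j _.
by have /eqP -> := xs (lift ord0 j); rewrite mul0r.
Qed.

Lemma unit_segment_coord0 x : unit_segment x -> 0 <= x 0 ord0 <= 1.
Proof. by move=> /(_ ord0). Qed.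

End PolytopeBoundary.

Section UpperBound.
Context {R : realType} {n : nat}.

Lemma hM_le_progression (m : nat) (a s : R) (J : set R) (u : R -> 'rV[R]_n.+1)
    (d : R -> R) (K : set 'rV[R]_n.+1) (sd : R -> bool) (A : set R) (q : R) :
  (0 < m)%N -> J = [set a + k%:R * s | k in [set k | (k < m)%N]] ->
  (forall j, J j -> dotp (u j) (u j) = 1) ->
  (forall j, J j -> u j 0 ord0 = d j * j) ->
  coord_bounded K ->
  K = \bigcap_(j in J) closed_side (u j) (d j) (sd j) ->
  contains_progressions m A -> (minkowski_dim A < q%:E)%E ->
  (hM (boundary K) <= (n%:R + q)%:E)%E.
Proof.
move=> m0 JE u1 hud [MK KM] KE Aprog /minkowski_dim_lt_rate Aq.
have [MA AM] := rate_bounded Aq.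
(* A shift large enough that the ratio [s * b + M - a * t] is positive for every [t] in [0, 1]. *)
pose M := `|s| * MA + `|a| + 1.
pose A' := [set s * x + M | x in A].
pose MB := 1 + (`|s| * MA + M + `|a|) * MK.
pose B k := [set y : 'rV[R]_n.+1 | (forall i, `|y 0 i| <= MB) /\
  [set d (a + k%:R * s) * x + 0 | x in A'] (dotp y (u (a + k%:R * s)))].
have bK : boundary K `<=` closure K by move=> y [].
have clKM y : closure K y -> forall i, `|y 0 i| <= MK.
  move=> cly i; apply/ler_addgt0Pr => e e0.
  have [x [/KM/(_ i) xM /row_ballP[_ /(_ i) xy]]] := cly _ (nbhsx_ballx y e e0).
  rewrite -[y 0 i](subrK (x 0 i)) (le_trans (ler_normD _ _))// addrC lerD//.
  exact: ltW.
have Bhom : contains_homothets (boundary K) (\bigcup_(k in [set k | (k < m)%N]) B k).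
  move=> x xseg; have /andP[t0 t1] := unit_segment_coord0 xseg.
  set t := x 0 ord0 in t0 t1.
  have [b Ab] := Aprog t (introT andP (conj t0 t1)).
  have /AM bM : A b by have := Ab 0%N m0; rewrite mul0r addr0.
  have sb : `|s * b| <= `|s| * MA by rewrite normrM ler_wpM2l.
  have at_ : `|a * t| <= `|a| by rewrite normrM ler_piMr// ger0_norm.
  exists (s * b + M - a * t).
    by move: sb at_; rewrite /M !ler_norml => /andP[? ?] /andP[? ?]; lra.
  move=> _ [p bp <-].
  have [j] := boundary_subset_hyperplanes JE KE bp.
  rewrite JE => -[k /= km <-] yj.
  exists k => //; split.
    move=> i; rewrite !mxE (le_trans (ler_normD _ _))// lerD//.
      have := xseg i; case: ifP => _; last by move/eqP ->; rewrite normr0.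
      by case/andP=> x0 x1; rewrite ger0_norm.
    rewrite normrM ler_pM//; last exact/clKM/bK.
    rewrite (le_trans (ler_normB _ _))// lerD//.
    rewrite (le_trans (ler_normD _ _))// lerD// ger0_norm//.
    by rewrite /M addr_ge0// addr_ge0// mulr_ge0// (le_trans _ bM).
  have Jk : J (a + k%:R * s) by rewrite JE; exists k.
  (* This is the ratio plus [(a + k%:R * s) * t]: the terms in [a * t] cancel. *)
  exists (s * (b + k%:R * t) + M); first by exists (b + k%:R * t) => //; exact: Ab.
  rewrite dotpDZl (dotp_unit_segment _ xseg) hud// yj -/t; ring.
apply: (@le_trans _ _ (minkowski_dim (\bigcup_(k in [set k | (k < m)%N]) B k))).
  by apply: ereal_inf_lbound; eexists; first exact: Bhom.
apply: rate_minkowski_dim_le; apply: rate_bigcup => k km.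
have Jk : J (a + k%:R * s) by rewrite JE; exists k.
have [i0 ui0] := unit_normal_coord (u1 _ Jk).
(* [rate_slab] wants a nonnegative bound [MB], which any point of [B k] provides. *)
have [B0|/set0P[y By]] := eqVneq (B k) set0; first by rewrite B0; exact: rate_set0.
apply: (rate_slab ui0); first by have [/(_ ord0)/(le_trans _)-> //] := By.
by do 2 apply: rate_affine.
Qed.

End UpperBound.

(** * Lower bound *)

HB.instance Definition _ (R : realType) (m n : nat) := Complete.on 'M[R]_(m, n).

(** If no [C i] contained a ball, the complements would be open and dense, and Baire's theorem would
    give a point of [U] outside every [C i]. *)
Lemma baire_countable (R : realType) (V : completeNormedModType R)
    (T : countType) (U : set V) (C : T -> set V) :
  open U -> U !=set0 -> (forall i, closed (C i)) -> U `<=` \bigcup_i C i ->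
  exists i x, exists2 e : R, 0 < e & ball x e `<=` C i.
Proof.
move=> oU U0 clC UC; apply: contrapT => noball.
(* Numbers that code no element of [T] contribute the whole space. *)
pose F k := ~` (if @unpickle T k is Some i then C i else set0).
have oF k : open (F k) /\ dense (F k).
  split; first by apply: closed_openC; case: unpickle => [i|]; [|exact: closed0].
  move=> O O0 oO; apply: contrapT => OF; apply: noball.
  have {}OF x : O x -> (if @unpickle T k is Some i then C i else set0) x.
    by move=> Ox; apply: contrapT => Fx; apply: OF; exists x.
  case: O0 => x Ox; case: (unpickle k) OF => [i|] OF; last by case: (OF x Ox).
  have /nbhs_ballP[e e0 eO] := open_nbhs_nbhs (conj oO Ox).
  by exists i, x, e => // y /eO/OF.
have [x [Ux Fx]] := Baire oF U0 oU.
have [i _ Cix] := UC x Ux.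
by have := Fx (pickle i) I; rewrite /F pickleK; exact.
Qed.

Section LowerBound.
Context {R : realType} {n : nat}.

Lemma closed_hyperplane_point (u : 'rV[R]_n.+1) (i0 : 'I_n.+1) (a : R)
    (G : set 'rV[R]_n.+1) : u 0 i0 != 0 -> closed G ->
  closed [set z | G (hyperplane_point u i0 z a)].
Proof.
move=> ui0 clG z clz; apply: clG => O /nbhs_ballP[e /= e0 eO].
have L0 := graph_lip_gt0 u i0.
have [|z' [Gz' /row_ballP[el0 zz']]] := clz (ball z (e / graph_lip u i0)).
  by apply: nbhsx_ballx; exact: divr_gt0.
exists (hyperplane_point u i0 z' a); split=> //; apply: eO.
rewrite -[e](divfK (lt0r_neq0 L0)) mulrC.
apply: ball_hyperplane_point => //.
by rewrite subrr normr0.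
Qed.

(* Cubes with corners in a lattice of mesh [N.+1^-1]: there are only countably
   many of them. *)
Definition in_lattice_cube (N : nat) (Z : {ffun 'I_n -> int}) (z : 'rV[R]_n) :=
  forall j, (Z j)%:~R / N.+1%:R <= z 0 j <= (Z j)%:~R / N.+1%:R + N.+1%:R^-1.

Lemma lattice_cube_in_ball (z : 'rV[R]_n) (e : R) : 0 < e ->
  exists N Z, forall z', in_lattice_cube N Z z' -> ball z e z'.
Proof.
move=> e0; pose N := Num.truncn e^-1.
have Ne : N.+1%:R^-1 < e.
  by rewrite -ltf_pV2 ?posrE ?invr_gt0// invrK truncnS_gt.
exists N, [ffun j => Num.floor (z 0 j * N.+1%:R)] => z' zz'.
apply/row_ballP; split => // j; have := zz' j; rewrite ffunE.
have /andP[] := floor_itv (z 0 j * N.+1%:R).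
rewrite -ler_pdivrMr// -ltr_pdivlMr// intrD mulrDl mul1r => f1 f2 /andP[f3 f4].
move: f1 f2 f3 f4 Ne; move: (N.+1%:R^-1) (_%:~R / _) => g f f1 f2 f3 f4 Ne.
by rewrite ltr_norml; apply/andP; split; lra.
Qed.

(** Around the image [w] of [y], the facet of the homothet is a graph over a ball in the coordinates
    other than [i0]. Baire's theorem there gives a smaller ball, hence a lattice cube, over which a
    single closure contains the graph. *)
Lemma facet_in_union (u : 'rV[R]_n.+1) (i0 : 'I_n.+1) (d j : R)
    (K P : set 'rV[R]_n.+1) (F : nat -> set 'rV[R]_n.+1) x (r : R) :
  u 0 i0 != 0 -> u 0 ord0 = d * j -> facet_hyperplane K u d ->
  K `&` hyperplane u d `<=` P ->
  unit_segment x -> 0 < r -> homothet P x r `<=` \bigcup_k F k ->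
  exists k N Z, forall z, in_lattice_cube N Z z ->
    closure (F k) (hyperplane_point u i0 z (d * (r + j * x 0 ord0))).
Proof.
move=> ui0 u0 [y [e [e0 yH yK]]] KP xseg r0 PF.
pose w := x + r *: y; set al := d * _.
have wal : dotp w u = al.
  by rewrite dotpDZl (dotp_unit_segment _ xseg) u0 yH /al; ring.
have L0 := graph_lip_gt0 u i0.
(* The radius [r * e / graph_lip u i0] keeps the graph within [r * e] of [w], so that the homothety
   pulls it back into [ball y e], where the hyperplane lies in [K]. *)
have [|||z /interior_subset/row_ballP[el0 wz]|k [z' [e' e'0 zF]]] :=
  @baire_countable R 'rV[R]_n nat
  (interior (ball (col' i0 w) (r * e / graph_lip u i0)))
  (fun k => [set z | closure (F k) (hyperplane_point u i0 z al)]).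
- exact: open_interior.
- by exists (col' i0 w); apply: nbhsx_ballx; rewrite divr_gt0// mulr_gt0.
- by move=> k; apply: closed_hyperplane_point => //; exact: closed_closure.
- set p := hyperplane_point u i0 z al.
  have /row_ballP[_ wp] : ball w (r * e) p.
    rewrite -[r * e](divfK (lt0r_neq0 L0)) mulrC.
    rewrite -{1}[w](hyperplane_pointK w ui0) wal.
    by apply: ball_hyperplane_point => //; rewrite subrr normr0.
  have pE : p = x + r *: (r^-1 *: (p - x)).
    by rewrite scalerA divff ?gt_eqF// scale1r addrC subrK.
  have [|k _ Fk] := PF p; last by exists k => //; exact: subset_closure.
  exists (r^-1 *: (p - x)); last by rewrite -pE.
  have pH : hyperplane u d (r^-1 *: (p - x)).
    have : dotp p u = al by exact: dotp_hyperplane_point.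
    rewrite {1}pE dotpDZl (dotp_unit_segment _ xseg) u0 /al => pal.
    by apply: (mulfI (lt0r_neq0 r0)); lra.
  apply: KP; split => //; apply: yK; split => //; apply/row_ballP; split => // i.
  rewrite -(ltr_pM2l r0) -[X in X * `|_|](gtr0_norm r0) -normrM mulrBr.
  have := wp i; rewrite /w [in X in X -> _]mxE.
  by rewrite {1}pE !mxE opprD addrACA subrr add0r.
have [N [Z NZ]] := lattice_cube_in_ball z' e'0.
by exists k, N, Z => z /NZ/zF.
Qed.

(** The set is the projection of a compact set of pairs [(t, r)]: the term at index 0 lies in the
    bounded set [A] and so bounds [r]. *)
Lemma closed_progression_parameters (m : nat) (h : nat -> R) (A : set R) (M : R) :
  (0 < m)%N -> closed A -> (forall x, A x -> `|x| <= M) ->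
  closed [set t | 0 <= t <= 1 /\
    exists r, forall k, (k < m)%N -> A (r + h k * t)].
Proof.
move=> m0 clA AM.
pose M' := M + `|h 0%N|.
pose E : set (R * R) := (`[0, 1] `*` `[- M', M']) `&`
  \bigcap_(k in [set k | (k < m)%N]) [set p | A (p.2 + h k * p.1)].
have -> : [set t | 0 <= t <= 1 /\ exists r, forall k, (k < m)%N -> A (r + h k * t)]
    = fst @` E.
  apply/seteqP; split => [t [t01 [r Ar]]|_ [[t r] [[/= t01 _] Er] <-]]; last first.
    by split; [rewrite in_itv in t01|exists r].
  exists (t, r) => //; split; last by move=> k /Ar.
  split; rewrite /= in_itv//=.
  have /AM := Ar _ m0; have : `|h 0%N * t| <= `|h 0%N|.
    by rewrite normrM ler_piMr// ger0_norm; case/andP: t01.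
  by rewrite /M' !ler_norml => /andP[? ?] /andP[? ?]; apply/andP; split; lra.
apply: compact_closed; first exact: Rhausdorff.
apply: continuous_compact.
  by apply: continuous_subspaceT => p; exact: cvg_fst.
have cB : compact ((`[0, 1] `*` `[- M', M']) : set (R * R)).
  by apply: compact_setX; exact: segment_compact.
have clE : closed E.
  apply: closedI; first by apply: compact_closed cB; exact: norm_hausdorff.
  apply: closed_bigI => k _.
  apply: (@preimage_closed _ _ (fun p : R * R => p.2 + h k * p.1)) => // p _.
  apply: cvgD; first exact: cvg_snd.
  by apply: cvgMl_tmp; exact: cvg_fst.
by apply: (subclosed_compact clE cB) => p [].
Qed.

(** At the parameter [t0 + e / 2 * t] the common difference is [s * t0 + c * t]; subtracting
    [k%:R * s * t0] from the [k]-th term and dividing by [c] leaves the difference [t]. *)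
Lemma progressions_from_interval (m : nat) (a s t0 e q : R) (A : set R) :
  s != 0 -> 0 < e -> covering_rate A q ->
  (forall t, ball t0 e t ->
    exists r, forall k, (k < m)%N -> A (r + (a + k%:R * s) * t)) ->
  exists2 A', contains_progressions m A' & covering_rate A' q.
Proof.
(* Half of [e] keeps [t0 + e / 2 * t] in the open ball even at [t = 1]. *)
move=> s0 e0 Aq At; pose c := s * (e / 2).
have c0 : c != 0 by rewrite mulf_neq0// gt_eqF// divr_gt0.
exists (\bigcup_(k in [set k | (k < m)%N])
  [set c^-1 * x + - (k%:R * s * t0 / c) | x in A]); last first.
  by apply: rate_bigcup => k _; exact: rate_affine.
move=> t /andP[t_ge0 t_le1].
have [|r Ar] := At (t0 + e / 2 * t).
  rewrite /ball/= opprD addrA subrr sub0r normrN ger0_norm; last first.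
    by rewrite mulr_ge0// ltW// divr_gt0.
  have : e / 2 * t <= e / 2 by rewrite ler_piMr// ltW// divr_gt0.
  by move/le_lt_trans; apply; rewrite ltr_pdivrMr// ltr_pMr// ltr1n.
exists ((r + a * (t0 + e / 2 * t)) / c) => k km.
exists k => //; eexists; first exact: Ar km.
by rewrite /c; field; rewrite s0 gt_eqF.
Qed.

End LowerBound.

Lemma progressions_from_homothets (R : realType) (n m : nat) (a s : R)
    (J : set R) (u : R -> 'rV[R]_n.+1) (d : R -> R) (K B : set 'rV[R]_n.+1)
    (sd : R -> bool) (F : nat -> set 'rV[R]_n.+1) (q : R) :
  (0 < m)%N -> s != 0 -> J = [set a + k%:R * s | k in [set k | (k < m)%N]] ->
  (forall j, J j -> dotp (u j) (u j) = 1) ->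
  (forall j, J j -> 0 < d j) ->
  (forall j, J j -> u j 0 ord0 = d j * j) ->
  K = \bigcap_(j in J) closed_side (u j) (d j) (sd j) ->
  (forall j, J j -> facet_hyperplane K (u j) (d j)) ->
  contains_homothets (boundary K) B -> B `<=` \bigcup_k F k ->
  (forall k, covering_rate (F k) q) ->
  exists2 A, contains_progressions m A & covering_rate A (q - n%:R).
Proof.
move=> m0 s0 JE u1 d0 hud KE Kfacet BK BF Fq.
pose h k : R := a + k%:R * s.
have Jh (l : 'I_m) : J (h l) by rewrite JE; exists l => /=.
have [i0 ui0] := fin_all_exists (fun l => unit_normal_coord (u1 _ (Jh l))).
(* [D] records for each face the index of a set [F k], a mesh and a cube. Such data form a countable
   type, so Baire's theorem can be used again, in [t]. *)
pose good (D : {ffun 'I_m -> nat * nat * {ffun 'I_n -> int}}) (t r : R) :=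
  forall l z, in_lattice_cube (D l).1.2 (D l).2 z ->
    closure (F (D l).1.1)
      (hyperplane_point (u (h l)) (i0 l) z (d (h l) * (r + h l * t))).
pose T D : set R := [set t | 0 <= t <= 1 /\ exists r, good D t r].
have T01 (t : R) : 0 <= t <= 1 -> exists D, T D t.
  move=> t01; pose x : 'rV[R]_n.+1 := \row_i (if i == ord0 then t else 0).
  have xseg : unit_segment x.
    move=> i; rewrite mxE; have [-> //|] := eqVneq i ord0.
    by rewrite -val_eqE => /negbTE/= ->.
  have [r r0 xB] := BK x xseg.
  have piece (l : 'I_m) : exists D : nat * nat * {ffun 'I_n -> int},
      forall z, in_lattice_cube D.1.2 D.2 z -> closure (F D.1.1)
      (hyperplane_point (u (h l)) (i0 l) z (d (h l) * (r + h l * t))).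
    have [|k [N [Z NZ]]] := facet_in_union (ui0 l) (hud _ (Jh l))
      (Kfacet _ (Jh l)) _ xseg r0 (subset_trans xB BF).
      move=> y [Ky yH]; apply: (supporting_subset_boundary (u1 _ (Jh l))) Ky yH.
      by rewrite {1}KE; exact: bigcap_inf (Jh l).
    by exists (k, N, Z) => z /NZ; rewrite mxE eqxx.
  have [D DP] := fin_all_exists piece.
  by exists [ffun l => D l]; split => //; exists r => l z; rewrite ffunE; exact: DP.
(* From here on [D] is fixed: the parameters that it serves are dense in a ball around [t0]. *)
have [||D|t tI|D [t0 [e e0 eT]]] :=
    @baire_countable R R {ffun 'I_m -> nat * nat * {ffun 'I_n -> int}}
    `]0, 1[%classic (fun D => closure (T D)).
- exact: interval_open.
- by exists 2^-1; rewrite /= in_itv/=; apply/andP; split; lra.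
- exact: closed_closure.
- have [|D DT] := T01 t; last by exists D => //; exact: subset_closure.
  by move: tI; rewrite /= in_itv/= => /andP[/ltW -> /ltW ->].
pose A := \bigcup_(k in [set k | (k < m)%N])
  [set x | exists t r, good D t r /\ x = r + h k * t].
have Aq : covering_rate (closure A) (q - n%:R).
  apply/rate_closure/rate_bigcup => k km; pose l := Ordinal km.
  have dl0 := d0 _ (Jh l).
  (* [rate_offsets] controls the offsets of face [l]; dividing them by [d (h l)] gives the terms
     [r + h l * t]. *)
  pose S := [set x | exists t r, good D t r /\ x = d (h l) * (r + h l * t)].
  have : covering_rate S (q - n%:R).
    apply: (@rate_offsets _ _ _ _ (closure (F (D l).1.1)) _
      (\row_j (((D l).2 j)%:~R / (D l).1.2.+1%:R)) (D l).1.2.+1%:R^-1 _ (ui0 l)).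
    - by rewrite invr_gt0.
    - move=> _ [t [r [gtr ->]]] z zc; apply: gtr => j.
      by have := zc j; rewrite mxE.
    - exact: rate_closure.
  move/(rate_affine (d (h l))^-1 0); apply: rate_subset.
  move=> _ [t [r [gtr ->]]]; exists (d (h l) * (r + h l * t)); first by exists t, r.
  by rewrite addr0 mulKf ?gt_eqF.
have [M AM] := rate_bounded Aq.
apply: (progressions_from_interval (m := m) (a := a) s0 e0 Aq) => t /eT.
(* Parameters in [T D] are only dense in the ball, but having a progression in [closure A] survives
   limits in [t]. *)
have clP := closed_progression_parameters (h := h) m0 (@closed_closure _ A) AM.
move=> clTt; have [_ //] : [set t | 0 <= t <= 1 /\
    exists r, forall k, (k < m)%N -> closure A (r + h k * t)] t.
apply: clP; apply: closureS clTt => t' [t'01 [r gr]]; split => //.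
by exists r => k km; apply: subset_closure; exists k => //; exists t', r.
Qed.

(** * Comparison of the two dimensions and conclusion *)

Lemma hP_le_hM (R : realType) (n : nat) (P : set 'rV[R]_n) :
  (hP P <= hM P)%E.
Proof.
apply/ereal_infP => _ [B BP <-]; apply: ge_ereal_inf; exists (packing_dim B).
  by exists B.
apply: ge_ereal_inf; exists (minkowski_dim B) => //.
(* The constant sequence is an admissible cover. *)
exists (fun=> B); first by move=> x Bx; exists 0%N.
rewrite (_ : range _ = [set minkowski_dim B]) ?ereal_sup1//.
by apply/seteqP; split => [_ [_ _ <-]//|_ ->]; exists 0%N.
Qed.

(** Covering rates have real exponents, so a bound by an extended real is tested on the reals above
    it. *)
Lemma lee_real_ub (R : realType) (x y : \bar R) :
  (forall r : R, (y < r%:E)%E -> (x <= r%:E)%E) -> (x <= y)%E.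
Proof.
case: y => [y| |] xr.
- by apply/lee_addgt0Pr => e e0; rewrite -EFinD; apply: xr; rewrite lte_fin ltrDl.
- exact: leey.
- by rewrite (eq_ninfty (fun r => xr r (ltNyr r))).
Qed.

Unset Implicit Arguments.

Theorem mainTheorem14 (R : realType) (n m : nat) (hn : (1 < n)%N)
    (J : set R) (u : R -> 'rV[R]_n) (d : R -> R) (K : set 'rV[R]_n)
    (hJ : arithmetic_progression m J)
    (hJ0 : ~ J 0)
    (hu : forall j, J j -> dotp (u j) (u j) = 1)
    (hd : forall j, J j -> 0 < d j)
    (hK : polytope_with_bounding_hyperplanes J u d K)
    (hud : forall j, J j -> d j = u j 0 (Ordinal (ltnW hn)) / j) :
  hM (boundary K) = hP (boundary K) /\
  hP (boundary K) = ((n%:R - 1)%:E + progression_dim R m)%E.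
Proof.
case: n hn u K hu hK hud => // n hn u K hu [Kbnd _ [sd KE] Kfacet] hud.
case: hJ => a [s [s0 JE]].
(* An empty family of half-spaces would make [K] the whole space, which is unbounded. *)
have m0 : (0 < m)%N.
  case: m JE => // JE; case: Kbnd => M KM.
  have : `|(const_mx (M + 1) : 'rV[R]_n.+1) 0 ord0| <= M.
    by apply: KM; rewrite KE => j; rewrite JE => -[].
  rewrite mxE leNgt => /negP; case.
  by rewrite (lt_le_trans _ (ler_norm _))// ltrDl.
have {}hud j : J j -> u j 0 ord0 = d j * j.
  move=> Jj; have j0 : j != 0 by apply: contra_notN hJ0 => /eqP <-.
  by rewrite hud// divfK//; congr (u j _ _); exact: val_inj.
have nE : n.+1%:R - 1 = n%:R :> R by rewrite -natr1 addrK.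
have up : (hM (boundary K) <= n%:R%:E + progression_dim R m)%E.
  rewrite -leeBlDl//; apply/ereal_infP => _ [A Aprog <-].
  apply: lee_real_ub => q Aq; rewrite leeBlDl// -EFinD.
  exact: (hM_le_progression m0 JE hu hud Kbnd KE Aprog Aq).
(* Bounding the smaller quantity [hP] suffices: [hP_le_hM] closes the cycle of inequalities. *)
have lo : (n%:R%:E + progression_dim R m <= hP (boundary K))%E.
  apply/ereal_infP => _ [B BK <-]; apply/ereal_infP => _ [F BF <-].
  apply: lee_real_ub => q Fq; rewrite -leeBrDl// -EFinB.
  have {}Fq k : covering_rate (F k) q.
    apply: minkowski_dim_lt_rate; apply: le_lt_trans Fq.
    by apply: ereal_sup_ubound; exists k.
  have [A Aprog Aq] :=
    progressions_from_homothets m0 s0 JE hu hd hud KE Kfacet BK BF Fq.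
  by apply: le_trans (rate_minkowski_dim_le Aq); apply: ereal_inf_lbound; exists A.
have hPM := hP_le_hM (boundary K).
rewrite nE; split; apply/eqP; rewrite eq_le.
  by rewrite hPM (le_trans up lo).
by rewrite lo (le_trans hPM up).
Qed.
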